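(* Every pseudoconvex truncated tube domain is a special domain for some special barrier $\alpha$. The converse is false, i.e. not every special domain is a pseudoconvex truncated tube domain.
   Context: Work in $\mathbb{C}^n$, $n\ge 2$, with $z=x+iy$, $x,y\in\mathbb{R}^n$, and $\|\cdot\|$ the Euclidean norm. $bA$ denotes the boundary of $A$. A truncated tube domain is a domain of the form $X+iY=\{x+iy: x\in X, y\in Y\}$, where $X,Y\subset\mathbb{R}^n$ are arbitrary domains. Good functions: a real-analytic function $\alpha:\mathbb{R}^n\to\mathbb{R}$ is a good $\mathcal{C}^\omega$ function if there is a holomorphic function $F_\alpha:\mathbb{C}^n\to\mathbb{C}$ with $F_\alpha|_{\mathbb{R}^n}=\alpha$; one then writes $\mathrm{Re}\,F_\alpha(x+iy)=\alpha(x)+f(x,y)$ for all $x,y\in\mathbb{R}^n$, and $f$ is called the (good) augmenting function of $\alpha$. Special barrier: a good $\mathcal{C}^\omega$ function $\alpha$ with augmenting function $f$ is a special barrier with respect to a convex set $Y\subset\mathbb{R}^n$ if for every fixed $y_0\in Y$ the real Hessian matrix $\left(\frac{\partial^2\left(\|x\|^2-(\alpha(x)+f(x,y_0))\right)}{\partial x_j\partial x_k}(\mathbf{x})\right)_{1\le j,k\le n}$ is positive definite for all $\mathbf{x}\in\mathbb{R}^n$; then $f$ is called a special augmenting function. Compact fence: for a special barrier $\alpha$ with respect to a convex domain $Y\subset\mathbb{R}^n$, with special augmenting function $f$, the compact fence given by $\alpha+f$ is $K_\alpha:=\{x+iy\in\mathbb{R}^n+i\overline{Y}: \|x\|^2\le\alpha(x)+f(x,y)\}$.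 Convex initial domain: a bounded strictly convex domain $X\subset\mathbb{R}^n$ with $\mathcal{C}^2$ boundary such that $K_\alpha\cap(bX+i\overline{Y})=\emptyset$. Here strictly convex means that at every boundary point $p$, with $r$ a local defining function ($X=\{r<0\}$ near $p$), $\sum_{j,k}a_ja_k\frac{\partial^2 r}{\partial x_j\partial x_k}(p)>0$ for all nonzero tangent vectors $\sum_j a_j\frac{\partial}{\partial x_j}|_p\in T_p(bX)$. Special domain: a domain of the form $S_\alpha:=(X+iY)\setminus K_\alpha$, where $\alpha$ is a special barrier with respect to a convex domain $Y$, $K_\alpha$ is the compact fence given by $\alpha+f$, and $X$ is a convex initial domain.
   Formalization: The first sentence is proved for X + iY with X a bounded strictly convex domain with C² boundary; without this it is false (C^n is a pseudoconvex truncated tube domain but special domains have bounded real part), and this condition on X is necessary. *)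

(* Defs.v *)
From HB Require Import structures.
From mathcomp Require Import all_boot all_order all_algebra.
From mathcomp Require Import complex.
From mathcomp Require Import all_classical all_reals all_analysis.

Set Implicit Arguments.
Unset Strict Implicit.
Unset Printing Implicit Defensive.

Import Order.TTheory GRing.Theory Num.Theory.
Import numFieldNormedType.Exports.

Local Open Scope classical_set_scope.
Local Open Scope ring_scope.
Local Open Scope complex_scope.

(* R[i] with its structures packed, so that the topology and the normed module
   structure that every numFieldType carries are inferred on it and on row
   vectors over it. *)
Definition Cplx (R : realType) : numClosedFieldType := R[i].

Section Vectors.
Context {R : realType} {n : nat}.
Implicit Types (x y : 'rV[R]_n) (z : 'rV[Cplx R]_n).

Definition revec z : 'rV[R]_n := \row_j complex.Re (z 0 j).

Definition imvec z : 'rV[R]_n := \row_j complex.Im (z 0 j).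

(* x + iy *)
Definition cvec x y : 'rV[Cplx R]_n := \row_j (x 0 j +i* y 0 j).

(* The library norm on 'rV is the sup norm; it gives the same open, closed and
   bounded sets, but the Euclidean norm is needed wherever a value of the norm
   matters. *)
Definition sqnorm x : R := \sum_j x 0 j ^+ 2.

Definition cnorm z : R := Num.sqrt (sqnorm (revec z) + sqnorm (imvec z)).

End Vectors.

Definition is_domain {T : topologicalType} (A : set T) : Prop :=
  [/\ A !=set0, open A & connected A].

Definition bd {T : topologicalType} (A : set T) : set T :=
  closure A `\` interior A.

(* X + iY *)
Definition tube {R : realType} {n : nat} (X Y : set 'rV[R]_n) :
    set 'rV[Cplx R]_n :=
  [set z | X (revec z) /\ Y (imvec z)].

Section Pseudoconvexity.
Context {R : realType} {n : nat}.
Implicit Types (W : set 'rV[Cplx R]_n) (u : 'rV[Cplx R]_n -> \bar R).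
Local Open Scope ereal_scope.

Definition cis (t : R) : Cplx R := cos t +i* sin t.

(* The two conditions on single points say that u is upper semicontinuous with
   values in [-oo, +oo[; the last one is the sub-mean value inequality on every
   closed complex disc { a + s b : |s| <= 1 } contained in W. *)
Definition plurisubharmonic W u : Prop :=
  [/\ forall a, W a -> u a < +oo,
      forall a, W a -> forall c : R, u a < c%:E ->
        \forall z \near a, u z < c%:E
    & forall a b : 'rV[Cplx R]_n,
        (forall s : Cplx R, (`|s| <= 1)%R -> W (a + s *: b)%R) ->
        u a <= ((2 * pi)^-1)%:E *
          \int[lebesgue_measure]_(t in `[0%R, (2 * pi)%R])
            u (a + cis t *: b)%R].

(* Euclidean distance to the complement; it is +oo when W is the whole space. *)
Definition dist_compl W (z : 'rV[Cplx R]_n) : \bar R :=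
  ereal_inf [set (cnorm (z - w)%R)%:E | w in ~` W].

(* -log of the boundary distance is plurisubharmonic *)
Definition pseudoconvex W : Prop :=
  plurisubharmonic W (fun z => - lne (dist_compl W z)).

Definition pseudoconvex_truncated_tube_domain W : Prop :=
  exists X Y : set 'rV[R]_n,
    [/\ is_domain X, is_domain Y, W = tube X Y & pseudoconvex W].

End Pseudoconvexity.

Section Calculus.
Context {R : realType} {n : nat}.
Implicit Types (g : 'rV[R]_n -> R) (x : 'rV[R]_n).

Definition partial (j : 'I_n) g x : R := 'D_(delta_mx 0 j) g x.

Definition hessian g x : 'M[R]_n := \matrix_(j, k) partial j (partial k g) x.

Definition posdef (A : 'M[R]_n) : Prop :=
  forall v : 'rV[R]_n, v != 0 -> 0 < (v *m A *m v^T) 0 0.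

Definition C2_near g (p : 'rV[R]_n) : Prop :=
  \forall x \near p, {for x, continuous g} /\
    forall j, [/\ derivable g x (delta_mx 0 j),
                  {for x, continuous (partial j g)}
                & forall k, derivable (partial j g) x (delta_mx 0 k) /\
                            {for x, continuous (partial k (partial j g))}].

(* sum of the terms of degree < N in each variable *)
Definition power_sum (c : {ffun 'I_n -> nat} -> R) (a x : 'rV[R]_n) (N : nat) :
    R :=
  \sum_(m : {ffun 'I_n -> 'I_N})
    c [ffun j => val (m j)] * \prod_j (x 0 j - a 0 j) ^+ m j.

Definition abs_power_sum (c : {ffun 'I_n -> nat} -> R) (a x : 'rV[R]_n)
    (N : nat) : R :=
  \sum_(m : {ffun 'I_n -> 'I_N})
    `|c [ffun j => val (m j)] * \prod_j (x 0 j - a 0 j) ^+ m j|.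

(* near every point, the sum of an absolutely convergent power series *)
Definition real_analytic g : Prop :=
  forall a : 'rV[R]_n, exists c : {ffun 'I_n -> nat} -> R,
    \forall x \near a,
      cvgn (abs_power_sum c a x) /\ power_sum c a x @ \oo --> g x.

Definition holomorphic (F : 'rV[Cplx R]_n -> Cplx R) : Prop :=
  forall z, differentiable F z.

End Calculus.

Section SpecialDomains.
Context {R : realType} {n : nat}.
Implicit Types (alpha : 'rV[R]_n -> R) (f : 'rV[R]_n -> 'rV[R]_n -> R).
Implicit Types X Y : set 'rV[R]_n.

(* alpha is a good analytic function and f is its augmenting function; F is
   determined by alpha, being entire and equal to alpha on R^n *)
Definition good_with_augmenting alpha f : Prop :=
  real_analytic alpha /\
  exists F : 'rV[Cplx R]_n -> Cplx R,
    [/\ holomorphic F,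
        forall x, F (cvec x 0) = (alpha x)%:C
      & forall x y, complex.Re (F (cvec x y)) = alpha x + f x y].

Definition special_barrier alpha f Y : Prop :=
  good_with_augmenting alpha f /\
  forall y0, Y y0 -> forall x,
    posdef (hessian (fun x' => sqnorm x' - (alpha x' + f x' y0)) x).

Definition compact_fence alpha f Y : set 'rV[Cplx R]_n :=
  tube setT (closure Y) `&`
  [set z | sqnorm (revec z) <= alpha (revec z) + f (revec z) (imvec z)].

Definition local_defining_function X (p : 'rV[R]_n) (r : 'rV[R]_n -> R) :
    Prop :=
  [/\ C2_near r p, exists j, partial j r p != 0
    & \forall x \near p, X x <-> r x < 0].

(* C^2 boundary, with Hessian positive on the tangent space at every boundary
   point; whether it is positive does not depend on the choice of r. *)
Definition strictly_convex_C2 X : Prop :=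
  forall p, bd X p ->
    exists r, local_defining_function X p r /\
      forall a : 'rV[R]_n, a != 0 -> \sum_j a 0 j * partial j r p = 0 ->
        0 < (a *m hessian r p *m a^T) 0 0.

(* Every special domain lies in X + iY with X of this kind, so a truncated tube
   domain can be special only under some restriction on its real part: R^n +
   iR^n is pseudoconvex and has no such representation. *)
Definition bounded_strictly_convex_domain X : Prop :=
  [/\ is_domain X, bounded_set X & strictly_convex_C2 X].

Definition convex_initial_domain X alpha f Y : Prop :=
  bounded_strictly_convex_domain X /\
  compact_fence alpha f Y `&` tube (bd X) (closure Y) = set0.

Definition special_domain alpha (W : set 'rV[Cplx R]_n) : Prop :=
  is_domain W /\
  exists f X Y,
    [/\ is_domain Y, convex_set (Y : set (convex_lmodType 'rV[R]_n)),
        special_barrier alpha f Y, convex_initial_domain X alpha f Y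
      & W = tube X Y `\` compact_fence alpha f Y].

End SpecialDomains.

(* Main.v *)
Require Import Defs.
From mathcomp Require Import all_boot all_order all_algebra.
From mathcomp Require Import all_classical all_reals all_analysis.
From mathcomp Require Import complex measurable_realfun.
From mathcomp Require Import ring lra.

Import numFieldNormedType.Exports.

Local Open Scope classical_set_scope.

Set Implicit Arguments.
Unset Strict Implicit.
Unset Printing Implicit Defensive.
Import Order.TTheory GRing.Theory Num.Theory.
Local Open Scope ring_scope.
Local Open Scope complex_scope.

(** First half.  The barrier alpha = -1 + |x|^2 / 2 extends to the entire function
    -1 + (z_1^2 + ... + z_n^2) / 2, and its fence
    { |x|^2 / 2 + |y|^2 / 2 <= -1 } is empty.  So X + iY is the special domain of
    alpha as soon as Y is convex, and the point is that pseudoconvexity forces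
    this.  The distance from x + iy to the complement of X + iY is the minimum
    of the distances from x to the complement of X and from y to the complement
    of Y, so when x stays at distance more than c from the complement of X, the
    plurisubharmonic function -log dist depends on y alone wherever it exceeds
    -log c.  Restrict it to a complex line with real direction b through
    x0 + ip.  If the distance to the complement of Y were smaller somewhere on
    the segment [p, p + b] of Y than at both ends and than c, its minimum m would
    be reached for a last time at an interior point; on a small disc around that
    point -log dist is at most -log m, and it is strictly less at the top of the
    disc, which contradicts the sub-mean value inequality.  This is
    [rdist_segment].  Consequently, for p fixed in Y, the set of q in Y whose
    segment [p, q] stays in Y is open and closed in Y, hence is the whole of Y
    ([pseudoconvex_tube_segment]).

    Second half.  The barrier |x|^2 / 2 has the fence
    { |x|^2 / 2 + |y|^2 / 2 <= 0 } = {0}, so the unit ball times iR^n, minus the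
    origin, is a special domain.  It is not a product X + iY: it contains
    x + i0 and 0 + iy for small nonzero x and y, but not 0 + i0
    ([punctured_tube_not_tube]). *)

(** * Topology of tubes *)

Section Continuity.
Context {R : realType} {n : nat}.

Lemma continuous_row (T : topologicalType) (K : numFieldType)
    (f : T -> 'rV[K]_n) :
  (forall j, continuous (fun t => f t 0 j)) -> continuous f.
Proof.
move=> cf t A /nbhs_ballP[e /= e0 eA].
have : \forall s \near t, forall j, ball (f t 0 j) e (f s 0 j).
  by apply: filter_forall => j; apply: (cf j t); exact: nbhsx_ballx.
apply: filterS => s /= sb; apply: eA; split => // i j.
by rewrite (ord1 i); exact: sb.
Qed.

Lemma Re_continuous : continuous (fun z : Cplx R => complex.Re z).
Proof.
move=> z A /nbhs_ballP[e /= e0 eA]; apply/nbhs_ballP.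
exists (e%:C : Cplx R) => /=; first by rewrite ltcR.
move=> w zw; apply: eA; change (`|complex.Re z - complex.Re w| < e).
have {}zw : `|(z - w : Cplx R)| < e%:C := zw.
rewrite -ltcR; apply: le_lt_trans zw.
apply: le_trans (normc_ge_Re (z - w)); rewrite lecR.
by case: z w => a b [c d].
Qed.

Lemma Im_continuous : continuous (fun z : Cplx R => complex.Im z).
Proof.
move=> z; have -> : (fun z : Cplx R => complex.Im z) =
    (fun z : Cplx R => complex.Re z) \o (fun z => (- 'i%C : Cplx R) * z).
  by apply/funext => -[a b] /=; ring.
apply: continuous_comp; last exact: Re_continuous.
exact: mulrl_continuous.
Qed.

Lemma complex_continuous (T : topologicalType) (f g : T -> R) :
  continuous f -> continuous g ->
  continuous (fun t => (f t +i* g t) : Cplx R).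
Proof.
move=> cf cg t A /nbhs_ballP[e /= e0 eA].
have eR : e = (complex.Re e)%:C.
  by move: e0; rewrite ltcE /=; case: e {eA} => a b /= /andP[/eqP-> _].
have e1 : 0 < complex.Re e / 2 by rewrite divr_gt0// -ltcR -eR.
have Hf : \forall s \near t, ball (f t) (complex.Re e / 2) (f s).
  exact: (cf t _ (nbhsx_ballx (f t) _ e1)).
have Hg : \forall s \near t, ball (g t) (complex.Re e / 2) (g s).
  exact: (cg t _ (nbhsx_ballx (g t) _ e1)).
apply: filterS2 Hf Hg => s fs gs.
have {}fs : `|f t - f s| < complex.Re e / 2 := fs.
have {}gs : `|g t - g s| < complex.Re e / 2 := gs.
apply: eA; change (`|(f t +i* g t) - (f s +i* g s) : Cplx R| < e); rewrite eR.
have -> : (f t +i* g t) - (f s +i* g s) =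
   (f t - f s)%:C + 'i%C * (g t - g s)%:C :> Cplx R.
  by rewrite -[RHS]/(Complex _ _); simpc.
apply: (le_lt_trans (ler_normD _ _)); rewrite normrM !normc_def /=.
rewrite !expr0n /= !addr0 add0r expr1n sqrtr1 !sqrtr_sqr mul1r.
by rewrite -rmorphD ltcR; lra.
Qed.

Lemma revec_continuous : continuous (@revec R n).
Proof.
apply: continuous_row => j z.
under [fun t => _]funext do rewrite mxE.
by apply: (@continuous_comp _ _ _ (fun w : 'rV[Cplx R]_n => w 0 j));
  [exact: coord_continuous|exact: Re_continuous].
Qed.

Lemma imvec_continuous : continuous (@imvec R n).
Proof.
apply: continuous_row => j z.
under [fun t => _]funext do rewrite mxE.
by apply: (@continuous_comp _ _ _ (fun w : 'rV[Cplx R]_n => w 0 j));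
  [exact: coord_continuous|exact: Im_continuous].
Qed.

Lemma cvec_continuous (T : topologicalType) (f g : T -> 'rV[R]_n) :
  continuous f -> continuous g -> continuous (fun t => cvec (f t) (g t)).
Proof.
move=> cf cg; apply: continuous_row => j.
under [fun t => _]funext do rewrite mxE.
apply: complex_continuous => t.
- by apply: (@continuous_comp _ _ _ f (fun w : 'rV[R]_n => w 0 j));
    [exact: cf|exact: coord_continuous].
- by apply: (@continuous_comp _ _ _ g (fun w : 'rV[R]_n => w 0 j));
    [exact: cg|exact: coord_continuous].
Qed.

Lemma revec_cvec (x y : 'rV[R]_n) : revec (cvec x y) = x.
Proof. by apply/rowP => j; rewrite !mxE. Qed.

Lemma imvec_cvec (x y : 'rV[R]_n) : imvec (cvec x y) = y.
Proof. by apply/rowP => j; rewrite !mxE. Qed.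

Lemma cvec_revec_imvec (z : 'rV[Cplx R]_n) : cvec (revec z) (imvec z) = z.
Proof. by apply/rowP => j; rewrite !mxE; case: (z 0 j). Qed.

Lemma sqnorm_continuous : continuous (@sqnorm R n).
Proof.
rewrite /sqnorm; apply: continuous_big => [|j _ x].
  exact: add_continuous.
by apply: (@continuous_comp _ _ _ (fun w : 'rV[R]_n => w 0 j)
  (fun s : R => s ^+ 2)); [exact: coord_continuous|exact: exprn_continuous].
Qed.

Lemma open_tube (X Y : set 'rV[R]_n) : open X -> open Y -> open (tube X Y).
Proof.
move=> oX oY; have -> : tube X Y = revec @^-1` X `&` imvec @^-1` Y by [].
by apply: openI; apply: open_comp => // z _;
  [exact: revec_continuous|exact: imvec_continuous].
Qed.

(** The tube is the union over x of crosses (X + iy0) u (x + iY), which share the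
    slice X + iy0. *)
Lemma connected_tube (X Y : set 'rV[R]_n) :
  connected X -> connected Y -> connected (tube X Y).
Proof.
move=> cX cY; have [[y0 Yy0]|Y0] := pselect (Y !=set0); last first.
  suff -> : tube X Y = set0 by exact: connected0.
  by apply/seteqP; split => // z [_ Yz]; apply: Y0; exists (imvec z).
have -> : tube X Y = \bigcup_(x in X)
    ((fun x' => cvec x' y0) @` X `|` (fun y => cvec x y) @` Y).
  apply/seteqP; split => [z [Xz Yz]|z [x Xx]].
    exists (revec z) => //; right; exists (imvec z) => //.
    exact: cvec_revec_imvec.
  by case=> [[x' ? <-]|[y ? <-]]; split; rewrite ?revec_cvec ?imvec_cvec.
have cXy : connected ((fun x' => cvec x' y0) @` X).
  apply: connected_continuous_connected => //; apply: continuous_subspaceT.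
  apply: (@cvec_continuous _ id (fun=> y0)) => u; last exact: cst_continuous.
  exact: cvg_id.
have [[x0 Xx0]|X0] := pselect (X !=set0); last first.
  rewrite bigcup0; first exact: connected0.
  by move=> x Xx; exfalso; apply: X0; exists x.
apply: bigcup_connected.
  by exists (cvec x0 y0) => x Xx; left; exists x0.
move=> x Xx; apply: connectedU => //.
  by exists (cvec x y0); split; [exists x|exists y0].
apply: connected_continuous_connected => //; apply: continuous_subspaceT.
apply: (@cvec_continuous _ (fun=> x) id) => u; first exact: cst_continuous.
exact: cvg_id.
Qed.

Lemma is_domain_tube (X Y : set 'rV[R]_n) :
  is_domain X -> is_domain Y -> is_domain (tube X Y).
Proof.
move=> [[x Xx] oX cX] [[y Yy] oY cY]; split.
- by exists (cvec x y); split; rewrite ?revec_cvec ?imvec_cvec.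
- exact: open_tube.
- exact: connected_tube.
Qed.

End Continuity.

(** * Euclidean distance to the complement *)

Section EuclideanDistance.
Context {R : realType} {n : nat}.
Implicit Types (x y : 'rV[R]_n) (z w : 'rV[Cplx R]_n) (X Y : set 'rV[R]_n).
Implicit Types W : set 'rV[Cplx R]_n.

Lemma sqnorm_ge0 x : 0 <= sqnorm x.
Proof. by apply: sumr_ge0 => j _; exact: sqr_ge0. Qed.

Lemma sqnorm_eq0 x : sqnorm x = 0 -> x = 0.
Proof.
move=> /eqP; rewrite psumr_eq0 => [/allP x0|j _]; last exact: sqr_ge0.
apply/rowP => j; rewrite mxE; apply/eqP.
by have := x0 j (mem_index_enum _); rewrite sqrf_eq0.
Qed.

Lemma sqnormZ k x : sqnorm (k *: x) = k ^+ 2 * sqnorm x.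
Proof.
by rewrite /sqnorm mulr_sumr; apply: eq_bigr => j _; rewrite mxE exprMn.
Qed.

Lemma revecD z w : revec (z + w) = revec z + revec w.
Proof. by apply/rowP => j; rewrite !mxE; case: (z 0 j) (w 0 j) => ? ? []. Qed.

Lemma imvecD z w : imvec (z + w) = imvec z + imvec w.
Proof. by apply/rowP => j; rewrite !mxE; case: (z 0 j) (w 0 j) => ? ? []. Qed.

Lemma revecN z : revec (- z) = - revec z.
Proof. by apply/rowP => j; rewrite !mxE; case: (z 0 j). Qed.

Lemma imvecN z : imvec (- z) = - imvec z.
Proof. by apply/rowP => j; rewrite !mxE; case: (z 0 j). Qed.

Lemma sqnorm0 : sqnorm (0 : 'rV[R]_n) = 0.
Proof. by apply: big1 => j _; rewrite mxE expr0n. Qed.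

Lemma sqnormN x : sqnorm (- x) = sqnorm x.
Proof. by apply: eq_bigr => j _; rewrite mxE sqrrN. Qed.

Lemma cnormN z : cnorm (- z) = cnorm z.
Proof. by rewrite /cnorm revecN imvecN !sqnormN. Qed.

Lemma cnorm_cvec x y : cnorm (cvec x y) = Num.sqrt (sqnorm x + sqnorm y).
Proof. by rewrite /cnorm revec_cvec imvec_cvec. Qed.

Lemma cnorm_ge0 z : 0 <= cnorm z. Proof. exact: sqrtr_ge0. Qed.

Lemma cnorm_sqr z : cnorm z ^+ 2 = sqnorm (revec z) + sqnorm (imvec z).
Proof. by rewrite sqr_sqrtr// addr_ge0// sqnorm_ge0. Qed.

Lemma cnorm_eq0 z : cnorm z = 0 -> z = 0.
Proof.
move=> z0; have := cnorm_sqr z; rewrite z0 expr0n /= => /esym/eqP.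
rewrite paddr_eq0 ?sqnorm_ge0// => /andP[/eqP/sqnorm_eq0 re0 /eqP/sqnorm_eq0 im0].
by rewrite -[z]cvec_revec_imvec re0 im0; apply/rowP => j; rewrite !mxE.
Qed.

Lemma cnorm0 : cnorm (0 : 'rV[Cplx R]_n) = 0.
Proof.
have -> : 0 = cvec 0 0 :> 'rV[Cplx R]_n by apply/rowP => j; rewrite !mxE.
by rewrite cnorm_cvec sqnorm0 addr0 sqrtr0.
Qed.

(** The inequality 0 <= |b z - a w|^2, with a and b the norms of z and w, gives
    the Cauchy-Schwarz inequality for the real scalar product of C^n, of which
    this is the usual consequence. *)
Lemma cnormD z w : cnorm (z + w) <= cnorm z + cnorm w.
Proof.
have [/cnorm_eq0->|z0] := eqVneq (cnorm z) 0; first by rewrite cnorm0 !add0r.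
have [/cnorm_eq0->|w0] := eqVneq (cnorm w) 0; first by rewrite cnorm0 !addr0.
have ab0 : 0 < cnorm z * cnorm w by rewrite mulr_gt0// lt_def cnorm_ge0 ?z0 ?w0.
pose dot x y := \sum_j x 0 j * y 0 j : R.
have sqD (k l : R) x y : sqnorm (k *: x + l *: y) =
    k ^+ 2 * sqnorm x + 2 * k * l * dot x y + l ^+ 2 * sqnorm y.
  rewrite /sqnorm /dot !mulr_sumr -!big_split /=.
  by apply: eq_bigr => j _; rewrite !mxE; ring.
have Ez := cnorm_sqr z; have Ew := cnorm_sqr w.
set a := cnorm z in ab0 Ez *; set b := cnorm w in ab0 Ew *.
have := addr_ge0 (sqnorm_ge0 (b *: revec z + - a *: revec w))
                 (sqnorm_ge0 (b *: imvec z + - a *: imvec w)).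
rewrite !sqD => H.
have C : dot (revec z) (revec w) + dot (imvec z) (imvec w) <= a * b.
  by rewrite -(ler_pM2l ab0); move: Ez Ew H; rewrite -!/a -!/b; nra.
rewrite -(@ler_pXn2r _ 2)// ?nnegrE ?addr_ge0 ?cnorm_ge0//.
rewrite cnorm_sqr revecD imvecD.
have := sqD 1 1 (revec z) (revec w); have := sqD 1 1 (imvec z) (imvec w).
rewrite !scale1r => -> ->; rewrite -/a -/b in Ez Ew *; nra.
Qed.

Lemma normr_le_cnorm z j : `|imvec z 0 j| <= cnorm z.
Proof.
rewrite -sqrtr_sqr ler_wsqrtr// -[leLHS]add0r lerD ?sqnorm_ge0//.
rewrite /sqnorm (bigD1 j)//= lerDl; apply: sumr_ge0 => i _; exact: sqr_ge0.
Qed.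

Lemma normr_le_sqrt_sqnorm x j : `|x 0 j| <= Num.sqrt (sqnorm x).
Proof.
have := normr_le_cnorm (cvec 0 x) j.
by rewrite imvec_cvec cnorm_cvec sqnorm0 add0r.
Qed.

Lemma open_euclidean Y y : open Y -> Y y -> exists2 e, 0 < e &
  forall y', Num.sqrt (sqnorm (y - y')) < e -> Y y'.
Proof.
move=> oY Yy; have /nbhs_ballP[e /= e0 eY] := open_nbhs_nbhs (conj oY Yy).
exists e => // y' yy'; apply: eY; split => // i j.
rewrite (ord1 i); change (`|y 0 j - y' 0 j| < e).
by have := le_lt_trans (normr_le_sqrt_sqnorm (y - y') j) yy'; rewrite !mxE.
Qed.

Local Open Scope ereal_scope.

Lemma dist_compl_lip W z z' :
  dist_compl W z <= dist_compl W z' + (cnorm (z - z'))%:E.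
Proof.
rewrite -leeBlDr//; apply: le_ereal_inf_tmp => _ [w Ww <-].
rewrite leeBlDr//; apply: ge_ereal_inf; exists (cnorm (z - w))%:E.
  by exists w.
rewrite -EFinD lee_fin [leRHS]addrC.
by rewrite (_ : z - w = (z - z') + (z' - w))%R ?cnormD// addrA subrK.
Qed.

Lemma dist_compl_le W z w : ~ W w -> dist_compl W z <= (cnorm (z - w))%:E.
Proof. by move=> Ww; apply: ereal_inf_lbound; exists w. Qed.

Lemma dist_compl_ge0 W z : 0 <= dist_compl W z.
Proof. by apply: le_ereal_inf_tmp => _ [w _ <-]; rewrite lee_fin cnorm_ge0. Qed.

Lemma dist_compl_fin W z w : ~ W w -> dist_compl W z \is a fin_num.
Proof.
move=> Ww; rewrite ge0_fin_numE ?dist_compl_ge0//.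
by rewrite (le_lt_trans (dist_compl_le z Ww))// ltry.
Qed.

(** The Euclidean distance from y to the complement of Y in R^n, obtained from
    dist_compl so that it inherits its properties. *)
Definition rdist Y y : \bar R := dist_compl (tube setT Y) (cvec 0 y).

Lemma cnorm_cvecB x y w :
  cnorm (cvec x y - w)%R = Num.sqrt (sqnorm (x - revec w) + sqnorm (y - imvec w)).
Proof. by rewrite /cnorm revecD imvecD revecN imvecN revec_cvec imvec_cvec. Qed.

Lemma rdist_le Y y y' : ~ Y y' -> rdist Y y <= (Num.sqrt (sqnorm (y - y')))%:E.
Proof.
move=> Yy'.
have := @dist_compl_le (tube setT Y) (cvec 0 y) (cvec 0 y').
rewrite cnorm_cvecB revec_cvec imvec_cvec subrr sqnorm0 add0r; apply.
by case=> _; rewrite imvec_cvec.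
Qed.

Lemma rdist_fin Y y y' : ~ Y y' -> rdist Y y \is a fin_num.
Proof.
move=> Yy'; apply: (@dist_compl_fin _ _ (cvec 0 y')).
by case=> _; rewrite imvec_cvec.
Qed.

Lemma rdist_lip Y y y' :
  rdist Y y <= rdist Y y' + (Num.sqrt (sqnorm (y - y')))%:E.
Proof.
have := dist_compl_lip (tube setT Y) (cvec 0 y) (cvec 0 y').
by rewrite cnorm_cvecB revec_cvec imvec_cvec subrr sqnorm0 add0r.
Qed.

Lemma rdist_gt0 Y y : open Y -> Y y -> 0 < rdist Y y.
Proof.
move=> oY Yy; have [e e0 eY] := open_euclidean oY Yy.
apply: (@lt_le_trans _ _ e%:E); first by rewrite lte_fin.
apply: le_ereal_inf_tmp => _ [w Ww <-]; rewrite lee_fin leNgt; apply/negP => we.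
apply: Ww; split => //; apply: eY; apply: le_lt_trans we.
by rewrite cnorm_cvecB ler_wsqrtr// lerDr sqnorm_ge0.
Qed.

(** Together with the next lemma, this is the part of
    dist (x + iy) = min (dist x) (dist y) that the maximum principle uses. *)
Lemma dist_compl_tube_le X Y x y :
  dist_compl (tube X Y) (cvec x y) <= rdist Y y.
Proof.
apply: le_ereal_inf_tmp => _ [w Ww <-].
apply: ge_ereal_inf; exists (cnorm (cvec x y - cvec x (imvec w)))%:E.
  exists (cvec x (imvec w)) => //; case=> _; rewrite imvec_cvec => Yw.
  by apply: Ww; split.
rewrite lee_fin !cnorm_cvecB revec_cvec imvec_cvec subrr sqnorm0 add0r.
by rewrite ler_wsqrtr// lerDr sqnorm_ge0.
Qed.

Lemma dist_compl_tube_ge X Y x y (c : R) :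
  (forall x', (Num.sqrt (sqnorm (x - x')) < c)%R -> X x') ->
  mine c%:E (rdist Y y) <= dist_compl (tube X Y) (cvec x y).
Proof.
move=> cX; apply: le_ereal_inf_tmp => _ [w Ww <-]; rewrite ge_min.
rewrite cnorm_cvecB.
have [Xw|Xw] := pselect (X (revec w)).
  apply/orP; right; apply: le_trans (@rdist_le Y y (imvec w) _) _.
    by move=> Yw; apply: Ww.
  by rewrite lee_fin ler_wsqrtr// lerDr sqnorm_ge0.
apply/orP; left; rewrite lee_fin leNgt; apply/negP => wc.
by apply: Xw; apply: cX; apply: le_lt_trans wc; rewrite ler_wsqrtr// lerDl sqnorm_ge0.
Qed.

End EuclideanDistance.

(** * Strict mean value inequality *)

(** The gap M - phi is nonnegative, and at least half of M - phi t1 on an interval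
    to the right of t1. *)
Lemma integral_lt_of_le (R : realType) (phi : R -> R) (a b t1 M : R) :
  continuous phi -> (forall t, phi t <= M) -> a < t1 < b -> phi t1 < M ->
  (\int[lebesgue_measure]_(t in `[a, b]) (phi t)%:E < (M * (b - a))%:E)%E.
Proof.
move=> cphi phiM /andP[at1 t1b] phit1.
have intc (f : R -> R) : continuous f -> lebesgue_measure.-integrable `[a, b] (EFin \o f).
  move=> cf; apply: continuous_compact_integrable; first exact: segment_compact.
  exact: continuous_subspaceT.
pose eps := (M - phi t1) / 2; have eps0 : 0 < eps by rewrite divr_gt0// subr_gt0.
have /cvgrPdist_lt/(_ eps eps0)/nbhs_ballP[d /= d0 dphi] := cphi t1.
pose l := Num.min (d / 2) (b - t1).
have l0 : 0 < l by rewrite lt_min divr_gt0//= subr_gt0.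
have ld : l < d by rewrite gt_min; apply/orP; left; lra.
have lb : t1 + l <= b by rewrite -lerBrDl ge_min lexx orbT.
have cg : continuous (fun t => M - phi t).
  by move=> t; apply: cvgB; [exact: cvg_cst|exact: cphi].
have mcg := continuous_measurable_fun cg.
have int_g : (0 < \int[lebesgue_measure]_(t in `[a, b]) (M - phi t)%:E)%E.
  apply: (@lt_le_trans _ _ (\int[lebesgue_measure]_(t in `[t1, (t1 + l)%R]) eps%:E)%E).
    rewrite integral_cst//= lebesgue_measure_itv/= lte_fin ltrDl l0 -EFinD.
    by rewrite addrAC subrr add0r -EFinM lte_fin mulr_gt0.
  apply: (@le_trans _ _ (\int[lebesgue_measure]_(t in `[t1, (t1 + l)%R]) (M - phi t)%:E)%E).
    apply: ge0_le_integral => //.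
    - by move=> t _; rewrite lee_fin ltW.
    - by apply/measurable_EFinP; apply: measurable_funTS; exact: mcg.
    - move=> t /=; rewrite in_itv/= => /andP[t1t tl]; rewrite lee_fin.
      have /dphi : ball t1 d t.
        by change (`|t1 - t| < d); rewrite distrC ger0_norm; lra.
      by rewrite ltr_distl => /andP[]; rewrite /eps; lra.
  apply: ge0_subset_integral => //.
  - by apply/measurable_EFinP; apply: measurable_funTS; exact: mcg.
  - by move=> t _; rewrite lee_fin subr_ge0.
  - by move=> t /=; rewrite !in_itv/= => /andP[? ?]; apply/andP; split; lra.
have intphi : (\int[lebesgue_measure]_(t in `[a, b]) (phi t)%:E \is a fin_num)%E.
  by apply: integrable_fin_num => //; exact: (intc _ cphi).
have : (\int[lebesgue_measure]_(t in `[a, b]) (phi t)%:E +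
  \int[lebesgue_measure]_(t in `[a, b]) (M - phi t)%:E = (M * (b - a))%:E)%E.
  rewrite -integralD//; [|exact: (intc _ cphi)|exact: (intc _ cg)].
  under eq_integral do rewrite -EFinD addrC subrK.
  rewrite integral_cst//= lebesgue_measure_itv/= lte_fin (lt_trans at1 t1b).
  by rewrite -EFinD -EFinM.
by move=> <-; rewrite lteDl.
Qed.

(** * Pseudoconvex tubes have convex imaginary part *)

Section Convexity.
Context {R : realType} {n : nat}.
Implicit Types (x y p q b : 'rV[R]_n) (z w : 'rV[Cplx R]_n) (X Y : set 'rV[R]_n).
Implicit Types W : set 'rV[Cplx R]_n.

Lemma cnorm_continuous : continuous (@cnorm R n).
Proof.
have csq : continuous (fun z => sqnorm (revec z) + sqnorm (imvec z) : R).
  move=> z; apply: (@continuousD _ _ _ (@sqnorm R n \o @revec R n)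
                                       (@sqnorm R n \o @imvec R n)).
  - by apply: continuous_comp; [exact: revec_continuous|exact: sqnorm_continuous].
  - by apply: continuous_comp; [exact: imvec_continuous|exact: sqnorm_continuous].
by move=> z; apply: (continuous_comp (csq z)); exact: sqrt_continuous.
Qed.

Lemma dist_compl_continuous W w : ~ W w ->
  continuous (fun z => fine (dist_compl W z)).
Proof.
move=> Ww z.
have fin z' := dist_compl_fin z' Ww.
have lip z1 z2 : fine (dist_compl W z1) <= fine (dist_compl W z2) + cnorm (z1 - z2).
  by rewrite -lee_fin EFinD !fineK//; exact: dist_compl_lip.
apply/(@cvgrPdist_lt R R^o _ (nbhs z) (nbhs_filter z)) => e e0.
have : cnorm (z' - z) @[z' --> z] --> 0.
  rewrite -(@cnorm0 R n) -(subrr z).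
  apply: (@continuous_comp _ _ _ (fun z' => z' - z) (@cnorm R n)).
    by apply: (@continuousD _ _ _ id (fun=> - z)) => //; exact: cst_continuous.
  exact: cnorm_continuous.
move=> /(@cvgrPdist_lt R R^o _ (nbhs z) (nbhs_filter z))/(_ e e0).
apply: filterS => z'.
rewrite sub0r normrN ger0_norm ?cnorm_ge0// => zz'.
have := lip z z'; have := lip z' z; rewrite -(cnormN (z - z')) opprB.
by rewrite ltr_distl => ? ?; apply/andP; split; lra.
Qed.

Lemma line_continuous (f : R -> R) x b :
  continuous f -> continuous (fun t => x + f t *: b).
Proof.
move=> cf; apply: continuous_row => j t.
under [fun t => _]funext do rewrite !mxE.
by apply: cvgD; [exact: cvg_cst|apply: cvgM; [exact: cf|exact: cvg_cst]].
Qed.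

Lemma rdist_line_continuous Y y p b : ~ Y y ->
  continuous (fun t : R => fine (rdist Y (p + t *: b))).
Proof.
move=> Yy t.
apply: (@continuous_comp _ _ _ (fun t : R => cvec 0 (p + t *: b))
  (fun z => fine (dist_compl (tube setT Y) z))).
  apply: (@cvec_continuous _ _ _ (fun=> 0) (fun t : R => p + t *: b)) => s.
    exact: cst_continuous.
  by apply: (line_continuous (f := id)) => ?; exact: cvg_id.
apply: (@dist_compl_continuous _ (cvec 0 y)).
by case=> _; rewrite imvec_cvec.
Qed.

Lemma cvec_disc x y b (r : R) (s : Cplx R) :
  cvec x y + s *: cvec (r *: b) 0 =
  cvec (x + (complex.Re s * r) *: b) (y + (complex.Im s * r) *: b).
Proof.
apply/rowP => j; rewrite !mxE; case: s => s1 s2.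
by rewrite -[LHS]/(Complex _ _) /=; congr Complex; ring.
Qed.

(** Maximum principle for -log dist on a disc with real direction b.  The disc is
    centred at the last minimum of the distance along the segment, so that its
    upper half escapes the minimum. *)
Lemma rdist_segment X Y x0 (c : R) y1 p b :
  0 < c -> (forall x', Num.sqrt (sqnorm (x0 - x')) < 2 * c -> X x') ->
  open Y -> ~ Y y1 -> pseudoconvex (tube X Y) ->
  (forall t : R, 0 <= t <= 1 -> Y (p + t *: b)) ->
  forall t : R, 0 <= t <= 1 ->
  (mine c%:E (mine (rdist Y p) (rdist Y (p + b))) <= rdist Y (p + t *: b))%E.
Proof.
move=> c0 cX oY Yy1 [_ _ submean] segY.
have [del [cdel delE]] : exists del : R -> R,
    continuous del /\ forall t, rdist Y (p + t *: b) = (del t)%:E.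
  exists (fun t => fine (rdist Y (p + t *: b))); split.
    exact: rdist_line_continuous Yy1.
  by move=> t; rewrite fineK// (rdist_fin _ Yy1).
have del_gt0 t : 0 <= t <= 1 -> 0 < del t.
  by move=> /segY Yt; rewrite -lte_fin -delE; exact: rdist_gt0.
have := delE 0; have := delE 1; rewrite scale0r scale1r addr0 => -> ->.
move=> t t01; rewrite delE leNgt; apply/negP; rewrite !lt_min !lte_fin.
move=> /and3P[tc t0 t1].
have [tm tm01 tm_min] : exists2 tm, tm \in `[0, 1]%R &
    forall s, s \in `[0, 1]%R -> del tm <= del s.
  by apply: EVT_min => //; exact: continuous_subspaceT.
set m := del tm.
have m_min s : 0 <= s <= 1 -> m <= del s by move=> s01; apply: tm_min; rewrite in_itv.
have mt : m <= del t by exact: m_min.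
have m0 : 0 < m by apply: del_gt0; move: tm01; rewrite in_itv.
(* the last point of the segment where the minimum is reached *)
have [eta [eta01 etam eta_last]] : exists eta, [/\ 0 <= eta <= 1, del eta = m &
    forall s, 0 <= s <= 1 -> eta < s -> m < del s].
  pose S := `[0, 1]%classic `&` del @^-1` [set m].
  have cS : compact S.
    apply: compact_closedI; first exact: segment_compact.
    by apply: (closed_comp (fun s _ => cdel s)); exact: closed_eq.
  have S0 : S !=set0 by exists tm; split => //=; move: tm01; rewrite in_itv.
  have [] := @compact_EVT_max _ R id S S0 cS.
    by apply: continuous_subspaceT => s; exact: cvg_id.
  move=> eta /set_mem[eta01 etam] eta_max.
  exists eta; split; [by move: eta01; rewrite /= in_itv|exact: etam|].
  move=> s s01 etas; rewrite lt_neqAle (m_min s s01) andbT.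
  apply/negP => /eqP sm.
  have Ss : S s by split; [rewrite /= in_itv|exact: esym sm].
  by have := eta_max s (mem_set Ss); rewrite leNgt etas.
have eta0 : eta != 0 by apply/eqP => e0; move: etam mt t0; rewrite e0; lra.
have eta1 : eta != 1 by apply/eqP => e0; move: etam mt t1; rewrite e0; lra.
have {eta01} /andP[eta_gt0 eta_lt1] : 0 < eta < 1.
  by case/andP: eta01 => h0 h1; rewrite !lt_def h0 h1 eta0 eq_sym eta1.
set bet := Num.sqrt (sqnorm b); have bet0 : 0 <= bet by exact: sqrtr_ge0.
(* the radius keeps the imaginary part of the disc on the segment, and its real
   part at distance at most c from x0 *)
have [r [r0 reta r1eta rc]] :
    exists r : R, [/\ 0 < r, r <= eta, r <= 1 - eta & r * bet <= c].
  exists (Num.min eta (Num.min (1 - eta) (c / (bet + 1)))).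
  have b1 : 0 < bet + 1 by lra.
  rewrite !lt_min !ge_min !lexx ?orbT subr_gt0 eta_gt0 eta_lt1 divr_gt0//=.
  split => //; apply: (@le_trans _ _ (c / (bet + 1) * bet)).
    by rewrite ler_wpM2r// !ge_min lexx ?orbT.
  by rewrite mulrAC ler_pdivrMr// ler_wpM2l ?ltW//; lra.
have imY s : `|s| <= 1 -> 0 <= eta + s * r <= 1.
  by rewrite ler_norml => /andP[? ?]; apply/andP; split; nra.
have imE s : p + eta *: b + (s * r) *: b = p + (eta + s * r) *: b.
  by rewrite scalerDl addrA.
have reX s x' : `|s| <= 1 ->
    Num.sqrt (sqnorm (x0 + (s * r) *: b - x')) < c -> X x'.
  move=> s1 sx'; apply: cX.
  have tri := cnormD (cvec 0 (x0 + (s * r) *: b - x')) (cvec 0 (- (s * r) *: b)).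
  have -> : x0 - x' = x0 + (s * r) *: b - x' + - (s * r) *: b.
    by apply/rowP => j; rewrite !mxE; ring.
  move: tri; have -> : forall u v : 'rV[R]_n, cvec 0 u + cvec 0 v = cvec 0 (u + v).
    move=> u v; apply/rowP => j; rewrite !mxE.
    by rewrite -[LHS]/(Complex _ _) addr0.
  rewrite !cnorm_cvec !sqnorm0 !add0r => /le_lt_trans; apply.
  rewrite [_ (- _ *: b)]sqnormZ sqrrN sqrtrM ?sqr_ge0// sqrtr_sqr normrM.
  rewrite (gtr0_norm r0) -/bet mulr_natl mulr2n; apply: ltr_leD => //.
  by apply: le_trans rc; rewrite -mulrA ler_piMl// mulr_ge0// ltW.
pose a := cvec x0 (p + eta *: b); pose v := cvec (r *: b) (0 : 'rV[R]_n).
have Re1 (s : Cplx R) : `|s| <= 1 -> `|complex.Re s| <= 1.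
  by move=> s1; rewrite -lecR; exact: le_trans (normc_ge_Re s) s1.
have Im1 (s : Cplx R) : `|s| <= 1 -> `|complex.Im s| <= 1.
  move=> s1; have := Re1 (s * 'i%C); rewrite ReiNIm normrN; apply.
  by rewrite normrM (_ : `|'i%C| = 1) ?mulr1// normc_def /= expr0n /= add0r expr1n sqrtr1.
have discW (s : Cplx R) : `|s| <= 1 -> tube X Y (a + s *: v).
  move=> s1; rewrite cvec_disc; split; rewrite ?revec_cvec ?imvec_cvec.
    apply: (reX _ _ (Re1 s s1)).
    by rewrite subrr sqnorm0 sqrtr0.
  by rewrite imE; apply: segY; exact: (imY _ (Im1 s s1)).
have Wy1 : ~ tube X Y (cvec 0 y1) by case=> _; rewrite imvec_cvec.
have [D [cD DE]] : exists D : 'rV[Cplx R]_n -> R,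
    continuous D /\ forall z, dist_compl (tube X Y) z = (D z)%:E.
  exists (fun z => fine (dist_compl (tube X Y) z)); split.
    exact: dist_compl_continuous Wy1.
  by move=> z; rewrite fineK// (dist_compl_fin _ Wy1).
have D_ge (s : Cplx R) : `|s| <= 1 ->
    Num.min c (del (eta + complex.Im s * r)) <= D (a + s *: v).
  move=> s1; rewrite -lee_fin -DE EFin_min -delE -imE cvec_disc.
  by apply: dist_compl_tube_ge => x'; apply: reX; exact: Re1.
have Da : D a <= m.
  by rewrite -etam -lee_fin -DE -delE; exact: dist_compl_tube_le.
have cis1 (th : R) : `|cis th : Cplx R| <= 1.
  by rewrite normc_def /= cos2Dsin2 sqrtr1.
have Dm (th : R) : m <= D (a + cis th *: v).
  apply: le_trans (D_ge _ (cis1 th)); rewrite le_min.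
  by rewrite (le_trans mt (ltW tc))/= m_min//; apply: imY; exact: (Im1 _ (cis1 th)).
pose phi th := - ln (D (a + cis th *: v)).
have cphi : continuous phi.
  move=> th; apply: cvgN; apply: continuous_cvg.
    by apply: continuous_ln; exact: lt_le_trans (Dm th).
  apply: (@continuous_comp _ _ _ (fun th => a + cis th *: v) D).
    have -> : (fun th => a + cis th *: v) = (fun th =>
        cvec (x0 + (cos th * r) *: b) (p + eta *: b + (sin th * r) *: b)).
      by apply/funext => th'; rewrite cvec_disc.
    apply: cvec_continuous; apply: line_continuous => th'.
    - by apply: cvgM; [exact: continuous_cos|exact: cvg_cst].
    - by apply: cvgM; [exact: continuous_sin|exact: cvg_cst].
  exact: cD.
have phi_le th : phi th <= - ln m.
  by rewrite lerN2 ler_ln ?posrE// (lt_le_trans m0).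
have pi2 : 0 < @pi R / 2 < 2 * pi.
  by have := pi_gt0 R => ?; apply/andP; split; lra.
(* the top of the disc lies above eta, hence strictly above the minimum *)
have phi_lt : phi (pi / 2) < - ln m.
  rewrite ltrN2; have Dtop : m < D (a + cis (pi / 2) *: v).
    apply: lt_le_trans (D_ge _ (cis1 _)); rewrite lt_min (le_lt_trans mt tc)/=.
    rewrite sin_pihalf mul1r; apply: eta_last; last by lra.
    by apply/andP; split; lra.
  by rewrite ltr_ln ?posrE// (lt_trans m0).
have := submean a v discW.
have -> : (fun th => (- lne (dist_compl (tube X Y) (a + cis th *: v)))%E) =
    (fun th => (phi th)%:E).
  apply/funext => th; rewrite DE lne_EFin//; exact: lt_le_trans (Dm th).
have Da0 : 0 < D a.
  rewrite -lte_fin -DE; apply: (@lt_le_trans _ _ (Num.min c (del eta))%:E).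
    by rewrite lte_fin lt_min c0 etam m0.
  have := D_ge 0; rewrite normr0 ler01 scale0r addr0 mul0r addr0 DE lee_fin; exact.
rewrite DE lne_EFin//; apply/negP; rewrite -ltNge.
apply: (@lt_le_trans _ _ (- ln m)%:E); last first.
  by rewrite lee_fin lerN2 ler_ln ?posrE.
have := integral_lt_of_le cphi phi_le pi2 phi_lt; rewrite subr0.
have tpi : 0 < 2 * @pi R by have := pi_gt0 R; lra.
by rewrite lte_pdivrMl// muleC EFinM.
Qed.

End Convexity.
Section TubeConvexity.
Context {R : realType} {n : nat}.
Implicit Types (x y p q : 'rV[R]_n) (X Y : set 'rV[R]_n).

Lemma near_euclidean x (e : R) :
  0 < e -> \forall x' \near x, Num.sqrt (sqnorm (x - x')) < e.
Proof.
move=> e0.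
have cf : continuous (fun x' => Num.sqrt (sqnorm (x - x'))).
  move=> x'; apply: (@continuous_comp _ _ _ (fun x' => x - x')
    (fun y => Num.sqrt (sqnorm y))).
    apply: (@continuousD _ _ _ (fun=> x) -%R); first exact: cst_continuous.
    exact: opp_continuous.
  apply: (@continuous_comp _ _ _ (@sqnorm R n) Num.sqrt).
    exact: sqnorm_continuous.
  exact: sqrt_continuous.
have := cf x; rewrite /continuous_at subrr sqnorm0 sqrtr0.
move=> /(@cvgrPdist_lt R R^o _ (nbhs x) (nbhs_filter x))/(_ e e0).
by apply: filterS => x'; rewrite sub0r normrN ger0_norm ?sqrtr_ge0.
Qed.

(** Both openness and closedness of the set B of points visible from p follow from
    one estimate: all of [p, q1] is at distance at least
    min (c, dist p, dist q1) from the complement of Y, so q1 may be moved by less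
    than that without the segment leaving Y. *)
Lemma pseudoconvex_tube_segment X Y : X !=set0 -> open X -> is_domain Y ->
  pseudoconvex (tube X Y) ->
  forall p q, Y p -> Y q -> forall t : R, 0 <= t <= 1 -> Y (p + t *: (q - p)).
Proof.
move=> [x0 Xx0] oX [_ oY cY] pc p q Yp Yq t t01.
have [[y1 Yy1]|] := pselect (exists y1, ~ Y y1); last first.
  by move=> /forallNP/(_ (p + t *: (q - p)))/contrapT.
have [e e0 eX] := open_euclidean oX Xx0.
have c0 : 0 < e / 2 by rewrite divr_gt0.
have cX x' : Num.sqrt (sqnorm (x0 - x')) < 2 * (e / 2) -> X x'.
  by rewrite mulrC divfK//; exact: eX.
have [del delE] : exists del, forall y, rdist Y y = (del y)%:E.
  by exists (fun y => fine (rdist Y y)) => y; rewrite fineK// (rdist_fin _ Yy1).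
have del_gt0 y : Y y -> 0 < del y.
  by move=> Yy; rewrite -lte_fin -delE rdist_gt0.
have del_lt y y' : Num.sqrt (sqnorm (y - y')) < del y -> Y y'.
  move=> yy'; apply: contrapT => /(rdist_le y); rewrite delE lee_fin leNgt.
  by rewrite yy'.
pose B := [set q | Y q /\ forall t : R, 0 <= t <= 1 -> Y (p + t *: (q - p))].
have step q1 q2 : B q1 -> Y q2 ->
    Num.sqrt (sqnorm (q1 - q2)) < Num.min (e / 2) (Num.min (del p) (del q1)) ->
    B q2.
  move=> [Yq1 segq1] Yq2 q12; split => // s s01.
  apply: (del_lt (p + s *: (q1 - p))).
  have := rdist_segment c0 cX oY Yy1 pc segq1 s01.
  rewrite addrC subrK !delE -!EFin_min lee_fin => /(lt_le_trans q12); apply: le_lt_trans.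
  have -> : p + s *: (q1 - p) - (p + s *: (q2 - p)) = s *: (q1 - q2).
    by apply/rowP => j; rewrite !mxE; ring.
  case/andP: s01 => s0 s1.
  by rewrite sqnormZ sqrtrM ?sqr_ge0// sqrtr_sqr ger0_norm// ler_piMl// sqrtr_ge0.
suff BY : B = Y by have [_] : B q by [rewrite BY]; exact.
apply: cY.
- by exists p; split => // s _; rewrite subrr scaler0 addr0.
- have oB : open B.
    rewrite openE => q1 Bq1.
    have r0 : 0 < Num.min (e / 2) (Num.min (del p) (del q1)).
      by rewrite !lt_min c0 !del_gt0//; case: Bq1.
    have Yq1 : Y q1 by case: Bq1.
    have nY : \forall q2 \near q1, Y q2 by exact: open_nbhs_nbhs.
    have nr := near_euclidean q1 r0.
    by apply: filterS2 nY nr => q2 Yq2 ?; exact: step Bq1 Yq2 _.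
  by exists B => //; apply/seteqP; split => [q1 [? ?]|q1 []].
- exists (closure B); first exact: closed_closure.
  apply/seteqP; split => [q1 Bq1|q2 [Yq2 clq2]].
    by split; [case: Bq1|exact: subset_closure].
  have r0 : 0 < Num.min (e / 2) (Num.min (del p) (del q2 / 2)).
    by rewrite !lt_min c0 !del_gt0//= divr_gt0// del_gt0.
  have [q1 [Bq1]] := clq2 _ (near_euclidean q2 r0).
  rewrite -[in X in X -> _]sqnormN opprB /= => q12; apply: (step q1) => //.
  move: (q12); rewrite !lt_min => /and3P[-> -> /= hq].
  have := rdist_lip Y q2 q1; rewrite !delE -EFinD lee_fin.
  rewrite -(sqnormN (q2 - q1)) opprB; lra.
Qed.

Lemma pseudoconvex_tube_convex X Y : X !=set0 -> open X -> is_domain Y ->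
  pseudoconvex (tube X Y) -> convex_set (Y : set (convex_lmodType 'rV[R]_n)).
Proof.
move=> X0 oX dY pc x y l /set_mem Yx /set_mem Yy; apply/mem_set.
have l01 : 0 <= l%:num <= 1 by rewrite ge0 le1.
have := pseudoconvex_tube_segment X0 oX dY pc Yy Yx l01.
congr Y; rewrite /conv /=.
by apply/rowP => j; rewrite !mxE /unstable.onem; ring.
Qed.

End TubeConvexity.

(** * Derivatives of the squared norm *)

Section QuadraticFunctions.
Context {R : realType} {n : nat}.
Implicit Types (x y v : 'rV[R]_n) (g : 'rV[R]_n -> R).

(** Differentiation of functions whose difference quotient l + h m is affine in h,
    such as coordinates and the squared norm. *)
Lemma is_derive_quadratic g x v (l m : R) :
  (forall h : R, g (h *: v + x) - g x = h * (l + h * m)) ->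
  is_derive x v g l.
Proof.
move=> gE.
have cv : h^-1 *: ((g \o shift x) (h *: v) - g x) @[h --> (0 : R)^'] --> l.
  have lin : (l + h * m) @[h --> (0 : R)^'] --> l.
    apply: cvg_within_filter.
    have : (l + h * m) @[h --> (0 : R)] --> l + 0 * m.
      by apply: cvgD; [exact: cvg_cst|apply: cvgM; [exact: cvg_id|exact: cvg_cst]].
    by rewrite mul0r addr0.
  apply: cvg_trans lin; apply: near_eq_cvg; near=> h => /=.
  have h0 : h != 0 by near: h; exact: nbhs_dnbhs_neq.
  by rewrite gE [RHS]mulrA mulVf// mul1r.
by apply: DeriveDef; [apply/cvg_ex; exists l|exact: (cvg_lim _ cv)].
Unshelve. all: by end_near. Qed.

Lemma sum_delta x j : \sum_i x 0 i * (delta_mx 0 j : 'rV[R]_n) 0 i = x 0 j.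
Proof.
rewrite (bigD1 j)//= mxE !eqxx mulr1 big1 ?addr0// => i ij.
by rewrite mxE eqxx (negbTE ij) mulr0.
Qed.

Lemma is_derive_sqnorm (c k : R) x v :
  is_derive x v (fun x => c + k * sqnorm x) (2 * k * \sum_i x 0 i * v 0 i).
Proof.
apply: (@is_derive_quadratic _ _ _ _ (k * sqnorm v)) => h.
rewrite opprD addrACA subrr add0r -mulrBr /sqnorm -sumrB.
rewrite mulrDr !mulr_sumr -big_split /=.
by apply: eq_bigr => i _; rewrite !mxE; ring.
Qed.

Lemma is_derive_coord (k : R) x v j :
  is_derive x v (fun x => k * x 0 j) (k * v 0 j).
Proof.
by apply: (@is_derive_quadratic _ _ _ _ 0) => h; rewrite !mxE; ring.
Qed.

Lemma partial_sqnorm (c k : R) j :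
  partial j (fun x => c + k * sqnorm x) = (fun x => 2 * k * x 0 j).
Proof.
apply/funext => x; rewrite /partial.
by rewrite (@derive_val _ _ _ _ _ _ _ (is_derive_sqnorm c k x _)) sum_delta.
Qed.

Lemma hessian_sqnorm (c k : R) x :
  hessian (fun x => c + k * sqnorm x) x = (2 * k)%:M.
Proof.
apply/matrixP => i j; rewrite !mxE partial_sqnorm /partial.
rewrite (@derive_val _ _ _ _ _ _ _ (is_derive_coord _ x _ j)) mxE eqxx /=.
by rewrite [j == i]eq_sym mulr_natr.
Qed.

Lemma posdef_scalar (k : R) : 0 < k -> posdef (k%:M : 'M[R]_n).
Proof.
move=> k0 v v0; rewrite mul_mx_scalar -scalemxAl mxE mulr_gt0//.
rewrite mxE; under eq_bigr do rewrite mxE -expr2.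
rewrite lt_def sqnorm_ge0 andbT; apply/eqP => /sqnorm_eq0 v00.
by rewrite v00 eqxx in v0.
Qed.

Lemma C2_sqnorm (c k : R) x : C2_near (fun x => c + k * sqnorm x) x.
Proof.
have cc (k' : R) j : continuous (fun x => k' * x 0 j).
  move=> y; apply: (@continuousM _ _ (fun=> k') (fun x : 'rV[R]_n => x 0 j)).
    exact: cst_continuous.
  exact: coord_continuous.
apply: (@filterE _ (nbhs x)) => y; split.
  apply: (@continuousD _ _ _ (fun=> c)); first exact: cst_continuous.
  apply: (@continuousM _ _ (fun=> k)); first exact: cst_continuous.
  exact: sqnorm_continuous.
move=> j; split.
- by have [] := is_derive_sqnorm c k y (delta_mx 0 j).
- by rewrite partial_sqnorm; exact: cc.
- move=> i; rewrite partial_sqnorm; split.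
    by have [] := is_derive_coord (2 * k) y (delta_mx 0 i) j.
  rewrite (_ : partial i _ = fun=> 2 * k * (delta_mx 0 i : 'rV[R]_n) 0 j).
    exact: cst_continuous.
  apply/funext => z; rewrite /partial.
  by rewrite (@derive_val _ _ _ _ _ _ _ (is_derive_coord _ z _ j)).
Qed.

End QuadraticFunctions.

(** * Analyticity of quadratic functions *)

Section PolynomialsAreAnalytic.
Context {R : realType} {n : nat}.
Implicit Types (x a : 'rV[R]_n) (m e : {ffun 'I_n -> nat}).

(** The partial sums of a power series with finitely many terms are eventually
    constant; G stands for its terms or for their absolute values. *)
Lemma sum_bounded_support (d N : nat) (G : {ffun 'I_n -> nat} -> R) :
  (d < N)%N -> (forall m, G m != 0 -> forall j, (m j <= d)%N) ->
  \sum_(m : {ffun 'I_n -> 'I_N}) G [ffun j => val (m j)] =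
  \sum_(m : {ffun 'I_n -> 'I_d.+1}) G [ffun j => val (m j)].
Proof.
move=> dN Gd.
pose h (m : {ffun 'I_n -> 'I_d.+1}) := [ffun j => widen_ord dN (m j)].
pose h' (m : {ffun 'I_n -> 'I_N}) : {ffun 'I_n -> 'I_d.+1} := [ffun j => inord (m j)].
rewrite (bigID (fun m : {ffun 'I_n -> 'I_N} => [forall j, (m j <= d)%N])) /=.
rewrite [X in _ + X]big1 ?addr0; last first.
  move=> m /forallPn[j mj]; apply/eqP; apply: contraNT mj => /Gd/(_ j).
  by rewrite ffunE.
rewrite (reindex_onto h h') /=; last first.
  move=> m /forallP md; apply/ffunP => j; apply: val_inj.
  by rewrite !ffunE /= inordK// ltnS.
rewrite [LHS](eq_bigl predT); last first.
  move=> m; apply/andP; split.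
    by apply/forallP => j; rewrite ffunE /= -ltnS.
  by apply/eqP/ffunP => j; apply: val_inj; rewrite !ffunE /= inordK.
by apply: eq_bigr => m _; congr G; apply/ffunP => j; rewrite !ffunE.
Qed.

Lemma sum_monomial (d : nat) e (u : 'I_n -> R) : (forall j, (e j <= d)%N) ->
  \sum_(m : {ffun 'I_n -> 'I_d.+1})
     ([ffun j => val (m j)] == e)%:R * \prod_j u j ^+ m j = \prod_j u j ^+ e j.
Proof.
move=> ed; rewrite (bigD1 [ffun j => inord (e j)])//= [X in _ + X]big1 ?addr0.
  rewrite (_ : _ == e); last first.
    by apply/eqP/ffunP => j; rewrite !ffunE inordK// ltnS.
  by rewrite mul1r; apply: eq_bigr => j _; rewrite ffunE inordK// ltnS.
move=> m mi; rewrite (_ : _ == e = false) ?mul0r//; apply/negbTE.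
apply: contra mi => /eqP me; apply/eqP/ffunP => j; apply: val_inj.
by rewrite ffunE /= inordK ?ltnS// -me ffunE.
Qed.

(** The expansion of g at a is a power series with finitely many terms, whose
    partial sums are constant from N = 3 on. *)
Lemma real_analytic_sum_quadratic (g : 'rV[R]_n -> R)
    (c0 : 'rV[R]_n -> R) (c : 'rV[R]_n -> 'I_n -> 'I_3 -> R) :
  (forall a x, g x = c0 a + \sum_i \sum_k c a i k * (x 0 i - a 0 i) ^+ k) ->
  real_analytic g.
Proof.
move=> gE a.
pose ei (i : 'I_n) (k : nat) : {ffun 'I_n -> nat} :=
  [ffun j => if j == i then k else 0%N].
pose e0 : {ffun 'I_n -> nat} := [ffun => 0%N].
pose co m := c0 a * (m == e0)%:R + \sum_i \sum_k c a i k * (m == ei i k)%:R.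
have co_supp m : co m != 0 -> forall j, (m j <= 2)%N.
  move=> com j; rewrite leqNgt; apply/negP => m3; move/eqP: com; apply.
  rewrite /co [m == e0](_ : _ = false) ?mulr0 ?add0r; last first.
    by apply/eqP => me; rewrite me ffunE in m3.
  rewrite big1// => i _; rewrite big1// => k _.
  rewrite (_ : _ == _ = false) ?mulr0//; apply/eqP => me.
  move: m3; rewrite me ffunE; case: ifP => // _.
  by rewrite ltnNge -ltnS ltn_ord.
exists co; apply: (@filterE _ (nbhs a)) => x.
pose G m := co m * \prod_j (x 0 j - a 0 j) ^+ m j.
have G_supp m : G m != 0 -> forall j, (m j <= 2)%N.
  by move=> Gm; apply: co_supp; apply: contraNneq Gm => com; rewrite /G com mul0r.
have GE N (m : {ffun 'I_n -> 'I_N}) : co [ffun j => val (m j)] *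
    \prod_j (x 0 j - a 0 j) ^+ m j = G [ffun j => val (m j)].
  by rewrite /G; congr (_ * _); apply: eq_bigr => j _; rewrite ffunE.
split.
  apply/cvg_ex; exists (abs_power_sum co a x 3); apply: cvg_near_cst.
  exists 3%N => // N /= N3; rewrite /abs_power_sum.
  under eq_bigr do rewrite GE; under [RHS]eq_bigr do rewrite GE.
  apply: (sum_bounded_support (G := fun m => `|G m|) N3) => m.
  by rewrite normr_eq0; exact: G_supp.
have -> : g x = power_sum co a x 3.
  rewrite (gE a) /power_sum.
  under [RHS]eq_bigr do rewrite /co mulrDl.
  rewrite big_split /=; congr (_ + _).
    under eq_bigr do rewrite -mulrA.
    rewrite -mulr_sumr sum_monomial => [|j]; last by rewrite ffunE.
    by rewrite big1 ?mulr1// => j _; rewrite ffunE expr0.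
  under [RHS]eq_bigr do rewrite mulr_suml.
  rewrite [RHS]exchange_big /=; apply: eq_bigr => i _.
  under [RHS]eq_bigr do rewrite mulr_suml.
  rewrite [RHS]exchange_big /=; apply: eq_bigr => k _.
  under [RHS]eq_bigr do rewrite -mulrA.
  rewrite -mulr_sumr sum_monomial => [|j]; last first.
    by rewrite ffunE; case: ifP => // _; rewrite -ltnS.
  congr (_ * _); rewrite (bigD1 i)//= ffunE eqxx big1 ?mulr1// => j ji.
  by rewrite ffunE (negbTE ji) expr0.
apply: cvg_near_cst; exists 3%N => // N /= N3; rewrite /power_sum.
under eq_bigr do rewrite GE; under [RHS]eq_bigr do rewrite GE.
exact: (sum_bounded_support N3).
Qed.

End PolynomialsAreAnalytic.

(** * The quadratic barrier *)

Section QuadraticBarrier.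
Context {R : realType} {n : nat}.
Implicit Types (x y : 'rV[R]_n) (z : 'rV[Cplx R]_n) (Y : set 'rV[R]_n).

Lemma sum_complex (f g : 'I_n -> R) :
  \sum_j (f j +i* g j : Cplx R) = (\sum_j f j) +i* (\sum_j g j).
Proof. by elim/big_rec3: _ => // j y1 y2 y3 _ ->. Qed.

(** The restriction to real vectors of c + (z_1^2 + ... + z_n^2) / 2. *)
Definition barrier (c : R) x : R := c + 2^-1 * sqnorm x.

Definition augment x y : R := - (2^-1 * sqnorm y).

Lemma real_analytic_barrier c : real_analytic (barrier c).
Proof.
apply: (@real_analytic_sum_quadratic _ _ _ (fun=> c) (fun a i (k : 'I_3) =>
  [:: 2^-1 * a 0 i ^+ 2; a 0 i; 2^-1]`_k)) => a x.
rewrite /barrier mulr_sumr; congr (_ + _); apply: eq_bigr => i _.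
by rewrite !big_ord_recl big_ord0 /=; field.
Qed.

Lemma holomorphic_sum_sqr (c k : Cplx R) :
  holomorphic (fun z : 'rV[Cplx R]_n => c + k * \sum_j z 0 j ^+ 2).
Proof.
move=> z; apply: differentiableD => //; apply: differentiableM => //.
pose co (j : 'I_n) : 'rV[Cplx R]_n -> Cplx R := fun z => z 0 j.
rewrite (_ : (fun _ => _) = \sum_j (co j * co j)).
  by apply: differentiable_sum => j; apply: differentiableM;
    exact: differentiable_coord.
by apply/funext => z'; rewrite fct_sumE.
Qed.

Lemma good_barrier c : good_with_augmenting (barrier c) augment.
Proof.
split; first exact: real_analytic_barrier.
exists (fun z => c%:C + (2^-1)%:C * \sum_j z 0 j ^+ 2).
have FE x y : c%:C + (2^-1)%:C * \sum_j cvec x y 0 j ^+ 2 =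
    (barrier c x + augment x y) +i* \sum_j x 0 j * y 0 j :> Cplx R.
  under eq_bigr do rewrite mxE.
  rewrite (eq_bigr (fun j =>
    (x 0 j ^+ 2 - y 0 j ^+ 2) +i* (2 * (x 0 j * y 0 j)))); last first.
    by move=> j _; rewrite expr2 -[LHS]/(Complex _ _); congr Complex; ring.
  rewrite sum_complex -mulr_sumr sumrB -/(sqnorm x) -/(sqnorm y).
  by rewrite -[LHS]/(Complex _ _) /barrier /augment; congr Complex; field.
split; first exact: holomorphic_sum_sqr.
- move=> x; rewrite FE /augment sqnorm0 mulr0 oppr0 addr0.
  by rewrite big1// => j _; rewrite mxE mulr0.
- by move=> x y; rewrite FE.
Qed.

Lemma special_barrier_barrier c Y : special_barrier (barrier c) augment Y.
Proof.
split; first exact: good_barrier.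
move=> y _ x.
rewrite (_ : (fun _ => _) = fun x' =>
  (2^-1 * sqnorm y - c) + 2^-1 * sqnorm x').
  by rewrite hessian_sqnorm; apply: posdef_scalar; rewrite mulfV.
by apply/funext => x'; rewrite /barrier /augment; field.
Qed.

(** The sign of augment turns the inequality |x|^2 <= c + |x|^2 / 2 - |y|^2 / 2
    into a bound on the norm of x + iy: the fence is a closed ball of C^n cut by
    R^n + i closure(Y). *)
Lemma compact_fence_barrier c Y : compact_fence (barrier c) augment Y =
  tube setT (closure Y) `&` [set z | 2^-1 * cnorm z ^+ 2 <= c].
Proof.
rewrite /compact_fence; congr (_ `&` _); apply/funext => z /=.
rewrite cnorm_sqr /barrier /augment; apply/propext.
by split => ?; lra.
Qed.

End QuadraticBarrier.

(** * A special domain that is not a tube *)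

Section PuncturedTube.
Context {R : realType} {n : nat}.
Implicit Types (x y : 'rV[R]_n) (z : 'rV[Cplx R]_n).

Lemma connected_of_joins (T : topologicalType) (A : set T) (e : T) :
  (forall a, A a -> exists C, [/\ connected C, C a, C e & C `<=` A]) ->
  connected A.
Proof.
move=> join; pose P := [set C : set T | [/\ connected C, C e & C `<=` A]].
have -> : A = \bigcup_(C in P) C.
  apply/seteqP; split => [a Aa|a [C [_ _ CA] Ca]]; last exact: CA.
  by have [C [cC Ca Ce CA]] := join a Aa; exists C.
by apply: bigcup_connected => [|C []//]; exists e => C [].
Qed.

Definition segment x y : set 'rV[R]_n :=
  (fun t : R => x + t *: (y - x)) @` `[0, 1].

Lemma connected_segment x y : connected (segment x y).
Proof.
apply: connected_continuous_connected; first exact: segment_connected.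
apply: continuous_subspaceT.
by apply: (line_continuous (f := id)) => t; exact: cvg_id.
Qed.

Lemma segment_left x y : segment x y x.
Proof. by exists 0; rewrite /= ?in_itv/= ?lexx ?ler01// scale0r addr0. Qed.

Lemma segment_right x y : segment x y y.
Proof. by exists 1; rewrite /= ?in_itv/= ?lexx ?ler01// scale1r addrC subrK. Qed.

Definition csegment x y x' y' : set 'rV[Cplx R]_n :=
  (fun t : R => cvec (x + t *: (x' - x)) (y + t *: (y' - y))) @` `[0, 1].

Lemma connected_csegment x y x' y' : connected (csegment x y x' y').
Proof.
apply: connected_continuous_connected; first exact: segment_connected.
apply: continuous_subspaceT; apply: cvec_continuous;
  by apply: (line_continuous (f := id)) => t; exact: cvg_id.
Qed.

Lemma csegment_left x y x' y' : csegment x y x' y' (cvec x y).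
Proof. by exists 0; rewrite /= ?in_itv/= ?lexx ?ler01// !scale0r !addr0. Qed.

Lemma csegment_right x y x' y' : csegment x y x' y' (cvec x' y').
Proof.
exists 1; rewrite /= ?in_itv/= ?lexx ?ler01// !scale1r.
by rewrite addrC subrK [y + _]addrC subrK.
Qed.

Definition unit_ball : set 'rV[R]_n := [set x | sqnorm x < 1].

Lemma unit_ball_segment x y : unit_ball x -> unit_ball y ->
  segment x y `<=` unit_ball.
Proof.
move=> x1 y1 _ [t /= + <-]; rewrite in_itv/= => /andP[t0 t1].
have : sqnorm (x + t *: (y - x)) <= (1 - t) * sqnorm x + t * sqnorm y.
  rewrite /sqnorm !mulr_sumr -big_split /=; apply: ler_sum => j _.
  rewrite !mxE -subr_ge0 (_ : _ - _ = t * (1 - t) * (y 0 j - x 0 j) ^+ 2).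
    by rewrite mulr_ge0 ?sqr_ge0// mulr_ge0// subr_ge0.
  by ring.
rewrite /unit_ball /= in x1 y1 *; move=> /le_lt_trans; apply.
set M := Num.max (sqnorm x) (sqnorm y).
have M1 : M < 1 by rewrite gt_max x1.
have xM : sqnorm x <= M by rewrite le_max lexx.
have yM : sqnorm y <= M by rewrite le_max lexx orbT.
by apply: le_lt_trans M1; nra.
Qed.

Lemma open_unit_ball : open unit_ball.
Proof.
have -> : unit_ball = @sqnorm R n @^-1` [set t | t < 1] by [].
by apply: open_comp => [z _|]; [exact: sqnorm_continuous|exact: open_lt].
Qed.

Lemma unit_ball0 : unit_ball 0. Proof. by rewrite /unit_ball /= sqnorm0. Qed.

Lemma is_domain_unit_ball : is_domain unit_ball.
Proof.
split; [by exists 0; exact: unit_ball0|exact: open_unit_ball|].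
apply: (connected_of_joins (e := 0 : 'rV[R]_n)) => x x1; exists (segment x 0).
split; [exact: connected_segment|exact: segment_left|exact: segment_right|].
exact: unit_ball_segment x1 unit_ball0.
Qed.

Lemma is_domain_setT : is_domain [set: 'rV[R]_n].
Proof.
split; [by exists 0|exact: openT|].
apply: (connected_of_joins (e := 0 : 'rV[R]_n)) => x _; exists (segment x 0).
by split => //; [exact: connected_segment|exact: segment_left|exact: segment_right].
Qed.

Lemma bounded_unit_ball : bounded_set unit_ball.
Proof.
exists 1; split; first exact: real1.
move=> M M1 x x1; apply: le_trans (ltW M1).
rewrite [leLHS]mx_normrE; apply: bigmax_le => // -[i j] _ /=; rewrite (ord1 i).
apply: le_trans (normr_le_sqrt_sqnorm x j) _.
by rewrite -(@sqrtr1 R) ler_wsqrtr// ltW.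
Qed.

Lemma strictly_convex_unit_ball : bounded_strictly_convex_domain unit_ball.
Proof.
split; [exact: is_domain_unit_ball|exact: bounded_unit_ball|].
move=> p [_ p1].
have p0 : p != 0.
  apply/eqP => p0; apply: p1; rewrite p0.
  by apply: open_nbhs_nbhs; split; [exact: open_unit_ball|exact: unit_ball0].
exists (fun x => -1 + 1 * sqnorm x); split.
  split; first exact: C2_sqnorm.
    have /rV0Pn[j pj] := p0; exists j.
    by rewrite partial_sqnorm mulr1 mulf_neq0// pnatr_eq0.
  apply: (@filterE _ (nbhs p)) => x.
  by rewrite /unit_ball /=; split => ?; lra.
move=> a a0 _; rewrite hessian_sqnorm; exact: posdef_scalar.
Qed.

Definition punctured_tube : set 'rV[Cplx R]_n :=
  tube unit_ball setT `\` [set 0].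

Lemma cvec_eq0 x y : cvec x y = 0 <-> x = 0 /\ y = 0.
Proof.
split=> [xy0|[-> ->]]; last by apply/rowP => j; rewrite !mxE.
have [] := (revec_cvec x y, imvec_cvec x y); rewrite xy0 => <- <-.
by split; apply/rowP => j; rewrite !mxE.
Qed.

Lemma unit_ball_half_delta j : unit_ball (2^-1 *: delta_mx 0 j).
Proof.
rewrite /unit_ball /= sqnormZ /sqnorm.
under eq_bigr do rewrite expr2.
by rewrite sum_delta mxE !eqxx mulr1 expr2; lra.
Qed.

(** Every point is joined to e0 by a segment that misses the origin, or else by
    two such segments through e1; the direction e1, independent of e0, is where
    n >= 2 enters. *)
Lemma is_domain_punctured_tube : (2 <= n)%N -> is_domain punctured_tube.
Proof.
move=> n2; have n1 : (0 < n)%N by exact: ltn_trans n2.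
pose i0 := Ordinal n1; pose i1 := Ordinal n2.
pose e0 : 'rV[R]_n := 2^-1 *: delta_mx 0 i0.
pose e1 : 'rV[R]_n := 2^-1 *: delta_mx 0 i1.
have half : (2^-1 : R) != 0 by rewrite invr_eq0 pnatr_eq0.
have e00 : e0 0 i0 = 2^-1 by rewrite !mxE !eqxx mulr1.
have e01 : e0 0 i1 = 0 by rewrite !mxE mulr0.
have e10 : e1 0 i0 = 0 by rewrite !mxE mulr0.
have e11 : e1 0 i1 = 2^-1 by rewrite !mxE !eqxx mulr1.
have eball j := @unit_ball_half_delta j.
have e0N0 : e0 <> 0 by move=> /rowP/(_ i0); rewrite e00 mxE => /eqP; exact/negP.
have coord (t : R) (u v : 'rV[R]_n) j :
    u + t *: (v - u) = 0 -> (1 - t) * u 0 j + t * v 0 j = 0.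
  by move=> /rowP/(_ j); rewrite !mxE => ?; lra.
have sub x y x' : unit_ball x -> unit_ball x' -> ~ csegment x y x' 0 0 ->
    csegment x y x' 0 `<=` punctured_tube.
  move=> x1 x'1 N0 z zs; split; last by move=> z0; apply: N0; rewrite -z0.
  case: zs => t t01 <-; split => //; rewrite revec_cvec.
  by apply: (unit_ball_segment x1 x'1); exists t.
split.
- exists (cvec e0 0); split; last by move=> /cvec_eq0[].
  by split => //; rewrite revec_cvec; exact: eball.
- have -> : punctured_tube = tube unit_ball setT `&` @cnorm R n @^-1` [set t | 0 < t].
    rewrite /punctured_tube; apply/seteqP; split => z [Wz z0]; split => //=.
      by rewrite lt_def cnorm_ge0 andbT; apply/eqP => /cnorm_eq0.
    by move=> zE; move: z0; rewrite /= zE cnorm0 ltxx.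
  apply: openI; first by apply: open_tube; [exact: open_unit_ball|exact: openT].
  by apply: open_comp => [z _|]; [exact: cnorm_continuous|exact: open_gt].
- apply: (connected_of_joins (e := cvec e0 0)) => z [[x1 _] z0].
  rewrite -[z]cvec_revec_imvec in z0 *.
  move: (revec z) (imvec z) x1 z0 => x y x1 z0.
  have [hit|] := pselect (csegment x y e0 0 0); last first.
    move=> /(sub _ _ _ x1 (eball _)) W; exists (csegment x y e0 0).
    split => //; first exact: connected_csegment.
      exact: csegment_left.
    exact: csegment_right.
  (* z is a negative multiple of e0, so the segment from z to e1 misses 0 *)
  have [x_i1 [x_i0 y0]] : x 0 i1 = 0 /\ (x 0 i0 = 0 -> x = 0) /\ y = 0.
    case: hit => t /=; rewrite in_itv/= => /andP[t0 t1] /cvec_eq0[xt yt].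
    have t1' : 1 - t != 0.
      apply/eqP => /subr0_eq tE; apply: e0N0; move: xt.
      by rewrite -tE scale1r addrC subrK.
    have scaled (u v : 'rV[R]_n) : u + t *: (v - u) = 0 -> v = 0 -> u = 0.
      move=> uv v0; apply/rowP => j; apply: (mulfI t1').
      by have := coord t u v j uv; rewrite v0 !mxE; lra.
    split.
      by apply: (mulfI t1'); have := coord _ _ _ i1 xt; rewrite e01; lra.
    split; last exact: scaled yt erefl.
    move=> xi0; have := coord _ _ _ i0 xt; rewrite xi0 e00 => tE.
    by move: xt; rewrite (_ : t = 0) ?scale0r ?addr0//; lra.
  have N1 : ~ csegment x y e1 0 0.
    case=> t /= _ /cvec_eq0[xt _].
    have := coord _ _ _ i1 xt; have := coord _ _ _ i0 xt.
    rewrite e10 e11 x_i1 => xt0 xt1; have tE : t = 0 by lra.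
    apply: z0; apply/cvec_eq0; split => //; apply: x_i0.
    by move: xt0; rewrite tE; lra.
  have N2 : ~ csegment e1 0 e0 0 0.
    case=> t /= _ /cvec_eq0[et _].
    have := coord _ _ _ i1 et; have := coord _ _ _ i0 et.
    by rewrite e00 e01 e10 e11; lra.
  exists (csegment x y e1 0 `|` csegment e1 0 e0 0); split.
  - apply: connectedU; [|exact: connected_csegment|exact: connected_csegment].
    by exists (cvec e1 0); split; [exact: csegment_right|exact: csegment_left].
  - by left; exact: csegment_left.
  - by right; exact: csegment_right.
  - by rewrite subUset; split; apply: sub => //; exact: eball.
Qed.

Lemma special_punctured_tube :
  (2 <= n)%N -> special_domain (barrier 0) punctured_tube.
Proof.
move=> n2; split; first exact: is_domain_punctured_tube.
have fence0 : compact_fence (barrier 0) augment [set: 'rV[R]_n] = [set 0].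
  rewrite compact_fence_barrier closureT; apply/seteqP; split => [z [_ /= z0]|z ->].
    apply: cnorm_eq0; apply/eqP; rewrite -sqrf_eq0 eq_le sqr_ge0 andbT; lra.
  by split => //=; rewrite cnorm0 expr0n mulr0.
exists augment, unit_ball, setT; split.
- exact: is_domain_setT.
- by move=> x y l _ _; rewrite inE.
- exact: special_barrier_barrier.
- split; first exact: strictly_convex_unit_ball.
  rewrite fence0; apply/seteqP; split => // z [-> [[_ bd0] _]].
  apply: bd0; rewrite (_ : revec 0 = 0); last by apply/rowP => j; rewrite !mxE.
  by apply: open_nbhs_nbhs; split; [exact: open_unit_ball|exact: unit_ball0].
- by rewrite fence0.
Qed.

Lemma punctured_tube_not_tube (X Y : set 'rV[R]_n) :
  (2 <= n)%N -> punctured_tube <> tube X Y.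
Proof.
move=> n2; have n1 : (0 < n)%N by exact: ltn_trans n2.
pose e : 'rV[R]_n := 2^-1 *: delta_mx 0 (Ordinal n1).
have e_ball : unit_ball e by exact: unit_ball_half_delta.
have e_neq0 : e <> 0.
  move=> /rowP/(_ (Ordinal n1)); rewrite !mxE !eqxx mulr1 => /eqP.
  by rewrite invr_eq0 pnatr_eq0.
move=> WXY.
have [Xe Y0] : tube X Y (cvec e 0).
  rewrite -WXY; split; last by move=> /cvec_eq0[].
  by split => //; rewrite revec_cvec.
have [X0 Ye] : tube X Y (cvec 0 e).
  rewrite -WXY; split; last by move=> /cvec_eq0[].
  by split => //; rewrite revec_cvec; exact: unit_ball0.
have [_] : punctured_tube (cvec 0 0).
  rewrite WXY; rewrite revec_cvec in X0; rewrite imvec_cvec in Y0.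
  by split; rewrite ?revec_cvec ?imvec_cvec.
by apply; apply/cvec_eq0.
Qed.

End PuncturedTube.

Theorem proposition4p8 (R : realType) (n : nat) (hn : (2 <= n)%N) :
  (forall X Y : set 'rV[R]_n,
     bounded_strictly_convex_domain X -> is_domain Y ->
     pseudoconvex (tube X Y) ->
     exists alpha : 'rV[R]_n -> R, special_domain alpha (tube X Y)) /\
  ~ (forall W : set 'rV[Cplx R]_n,
       (exists alpha : 'rV[R]_n -> R, special_domain alpha W) ->
       pseudoconvex_truncated_tube_domain W).
Proof.
split => [X Y cX dY pc|special_tube].
  have [dX _ _] := cX; have [X0 oX _] := dX.
  exists (barrier (-1)); split; first exact: is_domain_tube.
  have fence0 : compact_fence (barrier (-1)) augment Y = set0.
    rewrite compact_fence_barrier; apply/seteqP; split => // z [_ /=].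
    by have := sqr_ge0 (cnorm z); lra.
  exists augment, X, Y; split => //.
  - exact: pseudoconvex_tube_convex X0 oX dY pc.
  - exact: special_barrier_barrier.
  - by split => //; rewrite fence0 set0I.
  - by rewrite fence0 setD0.
have [|X [Y [_ _ WXY _]]] := special_tube (@punctured_tube R n).
  by exists (barrier 0); exact: special_punctured_tube.
exact: punctured_tube_not_tube WXY.
Qed.
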